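(* Let $d$ be an integer congruent to $0$ or $1$ modulo $4$ (possibly a perfect square, possibly $0$). Then $C(d,m)$ is finite for every nonzero integer $m$, and $C(d,mn)=C(d,m)\,C(d,n)$ whenever $m$ and $n$ are coprime nonzero integers.
   Context: Definition of $C(d,m)$. For an integer $d\equiv 0$ or $1\bmod 4$ and a nonzero integer $m$, let $F$ be the (nonempty) set of all binary quadratic forms $f=[a,b,c]:=aX^2+bXY+cY^2$ with integers $a,b,c$ satisfying $b^2-4ac=d$ (no primitivity or definiteness condition is imposed); each $f$ is also viewed as a function $\mathbb{Z}^2\to\mathbb{Z}$. The group $G:=\mathrm{SL}(2,\mathbb{Z})$ acts naturally on $F$ by linear substitution, $(fg)(z)=f(gz)$. Let $S\subset F$ be a system of representatives for the $G$-orbits in $F$. For $f\in S$, let $\mathrm{SO}(f)$ be the stabilizer of $f$ in $G$; it acts on the set $f^{-1}(m)=\{z\in\mathbb{Z}^2: f(z)=m\}$. Define $$C(d,m):=\sum_{f\in S}|\mathrm{SO}(f)\backslash f^{-1}(m)|,$$ which does not depend on the choice of $S$. *)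

(* Defs.v *)
From mathcomp Require Import all_boot all_order all_algebra.
From mathcomp Require Import all_classical all_reals all_analysis.
From mathcomp Require Import ring.

Set Implicit Arguments.
Unset Strict Implicit.
Unset Printing Implicit Defensive.

Import Order.TTheory GRing.Theory Num.Theory.
Local Open Scope classical_set_scope.
Local Open Scope ring_scope.

(* The triple (a, b, c) stands for the form a X^2 + b X Y + c Y^2. *)
Definition bqform : Type := (int * int * int)%type.

Definition bqeval (f : bqform) (z : 'cV[int]_2) : int :=
  let: (a, b, c) := f in
  a * z 0 0 ^+ 2 + b * z 0 0 * z 1 0 + c * z 1 0 ^+ 2.

Definition bqdisc (f : bqform) : int :=
  let: (a, b, c) := f in b ^+ 2 - 4 * a * c.

(* The forms of discriminant d: degenerate, definite, indefinite, primitive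
   and imprimitive forms are all included. *)
Definition bqforms (d : int) : set bqform := [set f | bqdisc f = d].

Definition SL2Z : set 'M[int]_2 := [set g | \det g = 1].

(* Coefficients of f (p X + q Y, r X + s Y), for g with rows (p, q), (r, s). *)
Definition bqsubst (f : bqform) (g : 'M[int]_2) : bqform :=
  let: (a, b, c) := f in
  let p := g 0 0 in let q := g 0 1 in
  let r := g 1 0 in let s := g 1 1 in
  (a * p ^+ 2 + b * p * r + c * r ^+ 2,
   2 * a * p * q + b * (p * s + q * r) + 2 * c * r * s,
   a * q ^+ 2 + b * q * s + c * s ^+ 2).

Lemma bqeval_subst (f : bqform) (g : 'M[int]_2) (z : 'cV[int]_2) :
  bqeval (bqsubst f g) z = bqeval f (g *m z).
Proof.
case: f => [[a b] c]; rewrite /bqeval /bqsubst !mxE !big_ord_recl !big_ord0 /=.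
have -> : lift ord0 ord0 = 1 :> 'I_2 by apply/val_inj.
have -> : ord0 = 0 :> 'I_2 by [].
ring.
Qed.

Definition SL2Z_orbit (f : bqform) : set bqform := [set bqsubst f g | g in SL2Z].

Definition representatives (d : int) (S : set bqform) : Prop :=
  S `<=` bqforms d /\
  forall f, bqforms d f -> exists! s, S s /\ SL2Z_orbit f s.

Definition SO (f : bqform) : set 'M[int]_2 :=
  [set g | SL2Z g /\ bqsubst f g = f].

Definition level (f : bqform) (m : int) : set 'cV[int]_2 :=
  [set z | bqeval f z = m].

(* The orbit space SO(f) \ f^-1(m), as a set of subsets of Z^2. *)
Definition level_orbits (f : bqform) (m : int) : set (set 'cV[int]_2) :=
  [set [set g *m z | g in SO f] | z in level f m].

(* C(d, m), computed with the system of representatives S of the forms of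
   discriminant d. The value lies in [0, +oo], because S is
   infinite for d = 0 and finiteness of the orbit spaces is not assumed;
   `counting` is the cardinality, +oo on infinite sets. *)
Definition C (R : realType) (S : set bqform) (m : int) : \bar R :=
  \esum_(f in S) counting (level_orbits f m).

(* Main.v *)
Require Import Defs.
From mathcomp Require Import all_boot all_order all_algebra finmap.
From mathcomp Require Import all_classical all_reals all_analysis.
From mathcomp Require Import ring zify.

Set Implicit Arguments.
Unset Strict Implicit.
Unset Printing Implicit Defensive.

Import Order.TTheory GRing.Theory Num.Theory.
Local Open Scope classical_set_scope.
Local Open Scope ring_scope.

(** C(d, m) counts the pairs (f, z) with f of discriminant d and f(z) = m, up
to the simultaneous action of SL(2, Z): choosing f in S fixes the form, and
what remains of the group is SO(f).

A pair can be normalized on the side of the vector instead. Since m is nonzero,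
so is z, and z is k times a primitive vector, which a matrix of SL(2, Z) maps
to (1, 0). Then z = (k, 0) and f = [a, b, c] with m = a k^2. The matrices that
still fix z are the unipotent ones, and they move b by multiples of 2a. Write
d = e^2 - 4 c0, which is what d = 0 or 1 mod 4 allows. Then b = e + 2t, and
b^2 - 4ac = d says that a c = t^2 + e t + c0. So the orbits of pairs correspond
to the pairs (k, t) where k^2 divides m and t is a root of t^2 + e t + c0
modulo a = m / k^2 ([exists_normal_form], [normal_form_unique],
[C_normal_data]).

There are finitely many such (k, t). If m and n are coprime, a square k^2
divides mn exactly when k = k1 k2 with k1^2 dividing m and k2^2 dividing n, in
a unique way, and the Chinese remainder theorem splits the roots modulo
mn / k^2 into pairs of roots modulo m / k1^2 and n / k2^2
([counting_normal_dataM]). *)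

(** * Counting *)

Lemma countingE (R : realType) (T : choiceType) (A : set T) :
  counting A = \esum_(x in A) 1%E :> \bar R.
Proof.
rewrite /counting; case: asboolP => finA.
  by rewrite esum_fset// fsbig_finite//= card_fset_sum1 sumEFin natr_sum.
apply/esym/eqyP => r r0.
have [B BA Br] := infinite_set_fset (Num.truncn r).+1 finA.
apply: esum_ge; exists [set` B] => //.
apply: (@le_trans _ _ (Num.truncn r).+1%:R%:E).
  by rewrite lee_fin ltW// truncnS_gt.
move: Br; rewrite -(@ler_nat R) -lee_fin => /le_trans; apply.
by rewrite fsbig_finite//= set_fsetK card_fset_sum1 sumEFin natr_sum.
Qed.

Lemma counting_setX (R : realType) (T U : choiceType) (A : set T) (B : set U) :
  finite_set A -> finite_set B ->
  counting (A `*` B) = (counting A * counting B)%E :> \bar R.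
Proof.
move=> finA finB.
have -> : A `*` B = A `*`` (fun=> B) by [].
rewrite countingE -(@esum_esum R _ _ A (fun=> B) (fun _ _ => 1%E))//.
under eq_esum do rewrite -countingE.
rewrite /counting !asboolT//= esum_fset//.
rewrite fsbig_finite//= sumEFin -EFinM; congr EFin.
by rewrite big_const_seq count_predT iter_addr addr0 mulr_natl.
Qed.

(** A bijection given by its graph: neither direction has to be written as a
function, so both counts below need only existence and uniqueness. *)
Lemma counting_rel (R : realType) (T : choiceType) (U : pointedType)
    (A : set T) (B : set U) (r : T -> U -> Prop) :
  (forall x, A x -> exists2 y, B y & r x y) ->
  (forall y, B y -> exists2 x, A x & r x y) ->
  (forall x y y', A x -> B y -> B y' -> r x y -> r x y' -> y = y') ->
  (forall x x' y, A x -> A x' -> B y -> r x y -> r x' y -> x = x') ->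
  counting A = counting B :> \bar R.
Proof.
move=> AB BA fun_r inj_r; rewrite !countingE.
pose e x := xget point [set y | B y /\ r x y].
have eP x : A x -> B (e x) /\ r x (e x).
  by move=> /AB[y By rxy]; apply: (@xgetPex _ point [set y | B y /\ r x y]); exists y.
rewrite [RHS](@reindex_esum _ _ _ A B e)//; split.
- by move=> x /eP[].
- move=> x x' /set_mem Ax /set_mem Ax' exx'.
  have [Be re] := eP _ Ax; have [_ re'] := eP _ Ax'.
  by apply: (inj_r x x' (e x)) => //; rewrite exx'.
- move=> y By; have [x Ax rxy] := BA _ By; exists x => //.
  by have [Be re] := eP _ Ax; apply: (fun_r x).
Qed.

(** * Roots of a quadratic polynomial modulo the cofactors of square divisors *)

Definition qval (e c t : int) : int := t ^+ 2 + e * t + c.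

Lemma qval_dvd (e c : int) (a t t' : int) :
  (a %| t - t')%Z -> (a %| qval e c t)%Z = (a %| qval e c t')%Z.
Proof.
move=> att'.
have -> : qval e c t = qval e c t' + (t + t' + e) * (t - t').
  by rewrite /qval; ring.
by rewrite rpredDr ?dvdz_mull.
Qed.

Lemma qval_modn (e c : int) (a : int) (t t' : nat) :
  t = t' %[mod `|a|] -> (a %| qval e c t)%Z = (a %| qval e c t')%Z.
Proof.
move=> tt'; apply: qval_dvd; rewrite -eqz_mod_dvd.
by rewrite -!(modz_abs _ a) !modz_nat tt'.
Qed.

(** The cofactor a = m / k^2 carries the sign of m, which is the sign of the
first coefficient of the normal form. For m != 0 the equation m = a k^2 forces
k > 0 and determines a. *)
Definition normal_data (e c m : int) : set (nat * nat) :=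
  [set kt | exists2 a : int, m = a * kt.1%:Z ^+ 2 &
                             (kt.2 < `|a|)%N /\ (a %| qval e c kt.2)%Z].

Lemma finite_normal_data (e c m : int) : m != 0 -> finite_set (normal_data e c m).
Proof.
move=> m0; apply: (@sub_finite_set _ _ (`I_(`|m|.+1) `*` `I_(`|m|.+1))).
  move=> [k t] [a /= ma [ta _]]; split => /=; nia.
by apply: finite_setX; apply: finite_II.
Qed.

(** The factors are the gcds of k with m and n: k divides m n, so k divides the
product of these two coprime gcds, and conversely. The square of the first gcd
divides m n and is prime to n, hence divides m. *)
Lemma square_split (m n k : nat) : coprime m n -> (k ^ 2 %| m * n)%N ->
  exists k1 k2, [/\ k = (k1 * k2)%N, (k1 ^ 2 %| m)%N & (k2 ^ 2 %| n)%N].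
Proof.
move=> mn kmn; exists (gcdn k m), (gcdn k n).
have co12 : coprime (gcdn k m) (gcdn k n).
  exact/(coprime_dvdl (dvdn_gcdr _ _))/(coprime_dvdr (dvdn_gcdr _ _)).
have co1n : coprime (gcdn k m) n by apply: (coprime_dvdl (dvdn_gcdr _ _)).
have co2m : coprime (gcdn k n) m.
  by rewrite coprime_sym; apply: (coprime_dvdr (dvdn_gcdr _ _)).
split.
- apply/eqP; rewrite eqn_dvd Gauss_dvd// !dvdn_gcdl !andbT.
  rewrite muln_gcdl !muln_gcdr !dvdn_gcd dvdn_mulr//= dvdn_mulr//= dvdn_mull//=.
  by apply: dvdn_trans kmn; rewrite dvdn_exp.
- rewrite -(@Gauss_dvdl _ m n) ?coprimeXl//.
  by apply: dvdn_trans kmn; rewrite dvdn_exp2r// dvdn_gcdl.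
- rewrite -(@Gauss_dvdr _ m n) ?coprimeXl//.
  by apply: dvdn_trans kmn; rewrite dvdn_exp2r// dvdn_gcdl.
Qed.

(** k1 divides l1 l2 and is prime to l2, hence divides l1; then exchange the
two factorizations. *)
Lemma split_unique (k1 k2 l1 l2 : nat) (m n : int) : coprimez m n ->
  (k1 %| `|m|)%N -> (l1 %| `|m|)%N -> (k2 %| `|n|)%N -> (l2 %| `|n|)%N ->
  (k1 * k2 = l1 * l2)%N -> k1 = l1.
Proof.
have half (a1 a2 b1 b2 : nat) : coprimez m n ->
    (a1 %| `|m|)%N -> (b2 %| `|n|)%N -> (a1 * a2 = b1 * b2)%N -> (a1 %| b1)%N.
  move=> mn am bn ab; rewrite -(@Gauss_dvdl _ _ b2); first by rewrite -ab dvdn_mulr.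
  exact/(coprime_dvdl am)/(coprime_dvdr bn).
move=> mn k1m l1m k2n l2n kl; apply/eqP; rewrite eqn_dvd.
by rewrite (half k1 k2 l1 l2)// (half l1 l2 k1 k2).
Qed.

Lemma mul_sq_dvd (m a : int) (k : nat) : m = a * k%:Z ^+ 2 -> (k %| `|m|)%N.
Proof. by move=> ->; rewrite abszM abszX dvdn_mull// dvdn_exp. Qed.

Lemma mul_sq_inj (m a b : int) (k : nat) : m != 0 ->
  m = a * k%:Z ^+ 2 -> m = b * k%:Z ^+ 2 -> a = b.
Proof. nia. Qed.

(** The correspondence is k = k1 k2 together with t = t1 modulo m / k1^2 and
t = t2 modulo n / k2^2; these two moduli are coprime with product
m n / k^2. *)
Lemma counting_normal_dataM (R : realType) (e c m n : int) :
  m != 0 -> n != 0 -> coprimez m n ->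
  counting (normal_data e c (m * n)) =
    (counting (normal_data e c m) * counting (normal_data e c n))%E :> \bar R.
Proof.
move=> m0 n0 mn; rewrite -counting_setX; try exact: finite_normal_data.
have co_dvd (a b : int) k l : m = a * k%:Z ^+ 2 -> n = b * l%:Z ^+ 2 ->
    coprime `|a| `|b|.
  move=> ma nb; apply: (@coprime_dvdl _ `|m|); first by rewrite ma abszM dvdn_mulr.
  by apply: (@coprime_dvdr _ `|n|); first by rewrite nb abszM dvdn_mulr.
pose r (x : nat * nat) (y : (nat * nat) * (nat * nat)) :=
  x.1 = (y.1.1 * y.2.1)%N /\
  exists a b : int, [/\ m = a * y.1.1%:Z ^+ 2, n = b * y.2.1%:Z ^+ 2,
    x.2 = y.1.2 %[mod `|a|] & x.2 = y.2.2 %[mod `|b|]].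
apply: (@counting_rel R _ _ _ _ r).
(* Existence of (k1, t1), (k2, t2): split k, and reduce t modulo each cofactor. *)
- move=> [k t] [a /= mna [ta qa]].
  have [|k1 [k2 [kE k1m k2n]]] := @square_split `|m| `|n| k mn.
    by rewrite -abszM mna abszM abszX dvdn_mull.
  have /dvdzP[a1 ma1] : (k1%:Z ^+ 2 %| m)%Z by rewrite dvdzE abszX.
  have /dvdzP[a2 na2] : (k2%:Z ^+ 2 %| n)%Z by rewrite dvdzE abszX.
  have aE : a = a1 * a2.
    apply: (@mul_sq_inj (m * n) _ _ k); rewrite ?mulf_neq0//.
    by rewrite ma1 na2 kE PoszM; ring.
  have a10 : (0 < `|a1|)%N.
    by rewrite absz_gt0; apply: contra_neq m0 => a10; rewrite ma1 a10 mul0r.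
  have a20 : (0 < `|a2|)%N.
    by rewrite absz_gt0; apply: contra_neq n0 => a20; rewrite na2 a20 mul0r.
  exists ((k1, t %% `|a1|), (k2, t %% `|a2|))%N; last first.
    by split => //=; exists a1, a2; split => //; rewrite modn_mod.
  split => /=.
    exists a1 => //=; split; first by rewrite ltn_mod.
    rewrite (@qval_modn _ _ _ _ t) ?modn_mod//.
    by apply: dvdz_trans qa; rewrite aE dvdz_mulr.
  exists a2 => //=; split; first by rewrite ltn_mod.
  rewrite (@qval_modn _ _ _ _ t) ?modn_mod//.
  by apply: dvdz_trans qa; rewrite aE dvdz_mull.
(* Existence of (k, t), by the Chinese remainder theorem. *)
- move=> [[k1 t1] [k2 t2]] [[a /= ma [ta qa]] [b /= nb [tb qb]]].
  have ab := co_dvd _ _ _ _ ma nb.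
  pose t := (chinese `|a| `|b| t1 t2 %% (`|a| * `|b|))%N.
  have t1E : t = t1 %[mod `|a|].
    by rewrite /t modn_dvdm ?dvdn_mulr// chinese_modl.
  have t2E : t = t2 %[mod `|b|].
    by rewrite /t modn_dvdm ?dvdn_mull// chinese_modr.
  exists (k1 * k2, t)%N; last by split => //=; exists a, b.
  exists (a * b) => /=; first by rewrite ma nb PoszM; ring.
  split; first by rewrite abszM ltn_mod muln_gt0 (leq_ltn_trans _ ta)// (leq_ltn_trans _ tb).
  by rewrite Gauss_dvdz// (qval_modn _ _ t1E) (qval_modn _ _ t2E) qa.
(* Uniqueness of (k1, t1), (k2, t2): residues below the modulus. *)
- move=> [k t] [[k1 t1] [k2 t2]] [[l1 s1] [l2 s2]] _.
  move=> [[a /= ma [ta _]] [b /= nb [tb _]]] [[a' /= ma' [sa _]] [b' /= nb' [sb _]]].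
  move=> [/= kE [a1 [b1 [/= ma1 nb1 tt1 tt2]]]].
  move=> [/= kE' [a2 [b2 [/= ma2 nb2 ts1 ts2]]]].
  have kl1 : k1 = l1.
    apply: (@split_unique k1 k2 l1 l2 m n) => //; last by rewrite -kE -kE'.
    + exact: mul_sq_dvd ma.
    + exact: mul_sq_dvd ma'.
    + exact: mul_sq_dvd nb.
    + exact: mul_sq_dvd nb'.
  have kl2 : k2 = l2.
    have k10 : (0 < k1)%N.
      rewrite lt0n; apply: contra_neq m0 => k10.
      by rewrite ma k10 expr0n mulr0.
    by move: kE; rewrite kE' -kl1 => /eqP; rewrite eqn_pmul2l// => /eqP.
  subst l1 l2.
  rewrite -(mul_sq_inj m0 ma ma') in sa; rewrite -(mul_sq_inj n0 nb nb') in sb.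
  rewrite -(mul_sq_inj m0 ma ma1) in tt1; rewrite -(mul_sq_inj n0 nb nb1) in tt2.
  rewrite -(mul_sq_inj m0 ma ma2) in ts1; rewrite -(mul_sq_inj n0 nb nb2) in ts2.
  have -> : t1 = s1 by rewrite -(modn_small ta) -(modn_small sa) -tt1 -ts1.
  have -> : t2 = s2 by rewrite -(modn_small tb) -(modn_small sb) -tt2 -ts2.
  by [].
(* Uniqueness of (k, t). *)
- move=> [k t] [l s] [[k1 t1] [k2 t2]] [a /= mna [ta _]] [a' /= mna' [sa' _]] _.
  move=> [/= kE [a1 [b1 [/= ma1 nb1 tt1 tt2]]]].
  move=> [/= lE [a2 [b2 [/= ma2 nb2 ts1 ts2]]]].
  have kl : k = l by rewrite kE.
  rewrite -(mul_sq_inj m0 ma1 ma2) in ts1; rewrite -(mul_sq_inj n0 nb1 nb2) in ts2.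
  have aE : a = a1 * b1.
    apply: (@mul_sq_inj (m * n) _ _ k); rewrite ?mulf_neq0//.
    by rewrite ma1 nb1 kE PoszM; ring.
  have mn0 : m * n != 0 by rewrite mulf_neq0.
  rewrite -kl in mna'; rewrite -(mul_sq_inj mn0 mna mna') aE abszM in sa'.
  rewrite aE abszM in ta.
  have co := co_dvd _ _ _ _ ma1 nb1.
  have : t == s %[mod `|a1| * `|b1|].
    by rewrite chinese_remainder// tt1 ts1 tt2 ts2 !eqxx.
  by rewrite !modn_small// => /eqP ->; rewrite kl.
Qed.

(** * Forms and matrices of size 2 *)

Definition mx2 (p q r s : int) : 'M[int]_2 :=
  \matrix_(i, j) if i == 0 then (if j == 0 then p else q)
                 else (if j == 0 then r else s).

Definition axis_vec (k : int) : 'cV[int]_2 := \col_i if i == 0 then k else 0.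

Lemma ord2P (P : 'I_2 -> Prop) : P 0 -> P 1 -> forall i, P i.
Proof.
move=> P0 P1 i; case: (eqVneq i 0) => [->//|i0].
by have -> : i = 1 by apply/val_inj; case: i i0 => [[|[|]]].
Qed.

Lemma mulmx2E n (g : 'M[int]_2) (h : 'M[int]_(2, n)) i j :
  (g *m h) i j = g i 0 * h 0 j + g i 1 * h 1 j.
Proof.
rewrite mxE !big_ord_recl big_ord0 addr0.
by have -> : lift ord0 ord0 = 1 :> 'I_2 by apply/val_inj.
Qed.

Lemma det2E (g : 'M[int]_2) : \det g = g 0 0 * g 1 1 - g 0 1 * g 1 0.
Proof.
rewrite (expand_det_row _ 0) !big_ord_recl big_ord0 addr0 /cofactor !det_mx11 !mxE /=.
have -> : lift ord0 ord0 = 1 :> 'I_2 by apply/val_inj.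
have -> : lift 1 0 = 0 :> 'I_2 by apply/val_inj.
have -> : ord0 = 0 :> 'I_2 by [].
by rewrite !addn0 expr0 [bump 0 0]/= expr1; ring.
Qed.

Lemma bqsubst1 f : bqsubst f 1%:M = f.
Proof.
by case: f => [[a b] c]; rewrite /bqsubst !mxE /=; congr (_, _, _); ring.
Qed.

Lemma bqsubstM f g h : bqsubst f (g *m h) = bqsubst (bqsubst f g) h.
Proof.
by case: f => [[a b] c]; rewrite /bqsubst !mulmx2E; congr (_, _, _); ring.
Qed.

Lemma bqdisc_subst f g : bqdisc (bqsubst f g) = bqdisc f * (\det g) ^+ 2.
Proof. by case: f => [[a b] c]; rewrite /bqsubst /bqdisc det2E; ring. Qed.

(** * Normal form of a form with a marked vector *)

(** The right action on forms is paired with the inverse action on vectors, so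
that bqeval x.1 x.2 is constant on classes. *)
Definition equiv_at (x y : bqform * 'cV[int]_2) : Prop :=
  exists2 g, SL2Z g & bqsubst x.1 g = y.1 /\ x.2 = g *m y.2.

Lemma equiv_at_trans x y z : equiv_at x y -> equiv_at y z -> equiv_at x z.
Proof.
move=> [g Gg [fg zg]] [h Gh [fh zh]]; exists (g *m h).
  by rewrite /SL2Z /= det_mulmx Gg Gh mulr1.
by rewrite bqsubstM fg fh zg zh mulmxA.
Qed.

Lemma SL2Z_inv g : SL2Z g -> exists2 h, SL2Z h & g *m h = 1%:M /\ h *m g = 1%:M.
Proof.
move=> Gg; have ug : g \in unitmx by rewrite unitmxE Gg unitr1.
exists (invmx g); last by rewrite mulmxV ?mulVmx.
by rewrite /SL2Z /= det_inv Gg invr1.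
Qed.

Lemma equiv_at_sym x y : equiv_at x y -> equiv_at y x.
Proof.
move=> [g Gg [fg zg]]; have [h Gh [gh hg]] := SL2Z_inv Gg.
exists h => //; split; first by rewrite -fg -bqsubstM gh bqsubst1.
by rewrite zg mulmxA hg mul1mx.
Qed.

(** Bezout coefficients complete the primitive vector z / k to a matrix g of
SL(2, Z), so that z = g (k, 0). A unipotent matrix then reduces b modulo 2a. *)
Lemma exists_normal_form (e c0 m : int) (f : bqform) (z : 'cV[int]_2) :
  m != 0 -> bqdisc f = e ^+ 2 - 4 * c0 -> bqeval f z = m ->
  exists a (k t : nat) c, [/\ m = a * k%:Z ^+ 2, (t < `|a|)%N,
    a * c = qval e c0 t & equiv_at ((a, e + 2 * t%:Z, c), axis_vec k) (f, z)].
Proof.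
move=> m0 df fz.
pose k := gcdn `|z 0 0| `|z 1 0|.
have /dvdzP[p zp] : (k%:Z %| z 0%R 0%R)%Z by rewrite dvdzE dvdn_gcdl.
have /dvdzP[r zr] : (k%:Z %| z 1%R 0%R)%Z by rewrite dvdzE dvdn_gcdr.
have [u [v uv]] := Bezoutz (z 0 0) (z 1 0).
have {}uv : u * z 0 0 + v * z 1 0 = k by [].
have k0 : k%:Z != 0.
  apply: contra_neq m0 => k0; case: f fz {df} => [[a b] c] <-.
  by rewrite /bqeval zp zr k0; ring.
have det1 : p * u + v * r = 1.
  by apply: (mulIf k0); rewrite -[RHS]mul1r -[in RHS]uv zp zr; ring.
pose g := mx2 p (- v) r u.
have Gg : SL2Z g by rewrite /SL2Z /= det2E !mxE /= -det1; ring.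
have zg : z = g *m axis_vec k.
  apply/matrixP => i j; rewrite (ord1 j) mulmx2E !mxE /=.
  by elim/ord2P: i; rewrite /= ?zp ?zr; ring.
case E : (bqsubst f g) => [[a b] c].
have dF : b ^+ 2 - 4 * a * c = e ^+ 2 - 4 * c0.
  by have := bqdisc_subst f g; rewrite E Gg df expr1n mulr1.
have ma : m = a * k%:Z ^+ 2.
  by rewrite -fz zg -bqeval_subst E /bqeval !mxE /=; ring.
have a0 : a != 0 by apply: contra_neq m0 => a0; rewrite ma a0 mul0r.
(* b and e have the same parity because b^2 and e^2 agree modulo 4. *)
have /dvdzP[t' bt] : (2 %| b - e)%Z.
  have : (2 %| (b - e) ^+ 2)%Z.
    apply/dvdzP; exists (2 * (a * c - c0) - e * (b - e)).
    have -> : (b - e) ^+ 2 = (b ^+ 2 - 4 * a * c) - e ^+ 2 + 4 * a * c - 2 * e * (b - e).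
      by ring.
    by rewrite dF; ring.
  by rewrite !dvdzE abszX Euclid_dvdX// andbT.
have {}bt : b = e + 2 * t' by rewrite mulrC -bt; ring.
have qt' : a * c = qval e c0 t'.
  apply: (@mulfI _ 4) => //; rewrite /qval.
  have -> : 4 * (a * c) = b ^+ 2 - (b ^+ 2 - 4 * a * c) by ring.
  by rewrite dF bt; ring.
have : (t' %% a)%Z = `|(t' %% a)%Z|%:Z by rewrite gez0_abs// modz_ge0.
move: `|_|%N => t tE.
have ta : (t < `|a|)%N by rewrite -ltz_nat -tE; apply: ltz_mod.
have t'E := divz_eq t' a; rewrite tE in t'E; move: (t' %/ a)%Z t'E => n t'E.
(* The third coefficient after the substitution X -> X - n Y. *)
pose c' := a * n ^+ 2 - b * n + c.
exists a, k, t, c'; split => //.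
  by rewrite /c' !mulrDr qt' /qval bt t'E; ring.
apply: equiv_at_sym; exists (g *m mx2 1 (- n) 0 1).
  by rewrite /SL2Z /= det_mulmx Gg det2E !mxE /=; ring.
split=> /=.
  rewrite bqsubstM E /bqsubst !mxE /=; congr (_, _, _); rewrite /c' ?bt ?t'E; ring.
rewrite -mulmxA zg; congr (_ *m _); apply/matrixP => i j.
by rewrite mulmx2E !mxE /=; elim/ord2P: i => /=; ring.
Qed.

(** A matrix of SL(2, Z) that maps (k', 0) to (k, 0) with k, k' > 0 is upper
unipotent, hence changes t by a multiple of a. *)
Lemma normal_form_unique (e a c a' c' : int) (k k' t t' : nat) :
  (0 < k)%N -> (0 < k')%N -> (t < `|a|)%N -> (t' < `|a'|)%N ->
  equiv_at ((a, e + 2 * t%:Z, c), axis_vec k)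
           ((a', e + 2 * t'%:Z, c'), axis_vec k') ->
  k = k' /\ t = t'.
Proof.
move=> k0 k'0 ta t'a [g Gg [/= fg /matrixP zg]].
have := zg 0 0; have := zg 1 0; rewrite !mulmx2E !mxE /= !mulr0 !addr0.
move=> /esym/eqP; rewrite mulf_eq0 => /orP[/eqP g10 kE|]; last first.
  by rewrite eqz_nat; case: eqP k'0 => // ->.
move: Gg; rewrite /SL2Z /= det2E g10 mulr0 subr0 => gg.
have g00_gt0 : 0 < g 0 0 by rewrite -(@pmulr_lgt0 _ k'%:Z) ?ltz_nat// -kE ltz_nat.
have g00 : g 0 0 = 1.
  have : (g 0%R 0%R %| 1)%Z by apply/dvdzP; exists (g 1 1); rewrite mulrC.
  by rewrite dvdz1 => /eqP g001; rewrite -[LHS]gez0_abs ?ltW// g001.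
have g11 : g 1 1 = 1 by move: gg; rewrite g00 mul1r.
split; first by move: kE; rewrite g00; lia.
move: fg => [aE + _]; rewrite g00 g10 g11 => E.
have {}aE : a' = a by rewrite -aE g00 g10; ring.
rewrite aE in t'a.
have {}E : t'%:Z = t%:Z + a * g 0 1 by lia.
have : (t'%:Z = t%:Z %[mod a])%Z by rewrite E addrC mulrC modzMDl.
by rewrite -!(modz_abs _ a) !modz_nat !modn_small// => -[].
Qed.

(** * The orbit count *)

(** Both sides count the classes of equiv_at on the pairs (f, z) with
f(z) = m: the left one by the representative of f in S and an orbit of SO(f),
the right one by normal forms. *)
Lemma C_normal_data (R : realType) (d e c0 m : int) (S : set bqform) :
  d = e ^+ 2 - 4 * c0 -> representatives d S -> m != 0 ->
  C R S m = counting (normal_data e c0 m).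
Proof.
move=> dE [SF Srep] m0.
transitivity (counting (S `*`` level_orbits^~ m) : \bar R).
  rewrite countingE -(@esum_esum R _ _ S (level_orbits^~ m) (fun _ _ => 1%E))//.
  by apply: eq_esum => f _; rewrite countingE.
pose r (x : bqform * set 'cV[int]_2) (kt : nat * nat) :=
  exists a c z, [/\ m = a * kt.1%:Z ^+ 2, a * c = qval e c0 kt.2,
    x.2 = [set g *m z | g in SO x.1] &
    equiv_at ((a, e + 2 * kt.2%:Z, c), axis_vec kt.1) (x.1, z)].
have k_gt0 (a : int) (k : nat) : m = a * k%:Z ^+ 2 -> (0 < k)%N.
  by move=> ma; rewrite lt0n; apply: contra_neq m0 => k0; rewrite ma k0 expr0n mulr0.
apply: (@counting_rel R _ _ _ _ r).
(* Every orbit has a normal form. *)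
- move=> [f O] [/= Sf [z fz zO]].
  have [|a [k [t [c [ma ta ac kz]]]]] := exists_normal_form (e := e) (c0 := c0) m0 _ fz.
    by rewrite -dE; exact: SF.
  exists (k, t); last by exists a, c, z; split.
  by exists a => //; split => //; rewrite /= -ac dvdz_mulr.
(* Every normal form is carried to a form of S. *)
- move=> [k t] [a /= ma [ta /dvdzP[c qt]]].
  have [s [[Ss [g Gg sE]] _]] : exists! s, S s /\ SL2Z_orbit (a, e + 2 * t%:Z, c) s.
    apply: Srep; rewrite /bqforms /= /bqdisc dE.
    have -> : 4 * a * c = 4 * (c * a) by ring.
    by rewrite -qt /qval; ring.
  have [h Gh [gh hg]] := SL2Z_inv Gg.
  pose z := h *m axis_vec k.
  exists (s, [set g *m z | g in SO s]).
    split => //=; exists z => //; rewrite /level /= -sE bqeval_subst mulmxA gh mul1mx.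
    by rewrite /bqeval !mxE /= ma; ring.
  exists a, c, z; split => //; first by rewrite qt mulrC.
  by exists g => //; split => //; rewrite /= mulmxA gh mul1mx.
(* Two normal forms of one orbit agree. *)
- move=> [f O] [k t] [k' t'] _ [b /= mb [tb _]] [b' /= mb' [tb' _]].
  move=> [a [c [z [/= ma _ -> kz]]]] [a' [c' [z' [/= ma' _ Oz' kz']]]].
  have [h [Gh fh] zE] : [set g *m z' | g in SO f] z.
    rewrite -Oz'; exists 1%:M; last by rewrite mul1mx.
    by split; rewrite /SL2Z /= ?det1 ?bqsubst1.
  have zz' : equiv_at (f, z) (f, z') by exists h.
  have kk' := equiv_at_trans kz (equiv_at_trans zz' (equiv_at_sym kz')).
  have [k0 k'0] := (k_gt0 _ _ ma, k_gt0 _ _ ma').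
  rewrite (mul_sq_inj m0 mb ma) in tb; rewrite (mul_sq_inj m0 mb' ma') in tb'.
  by have [-> ->] := normal_form_unique k0 k'0 tb tb' kk'.
(* Two orbits with the same normal form: their forms are equivalent, hence
   equal because both lie in S, and then an element of SO f relates the
   vectors. *)
- move=> [f O] [f' O'] [k t] [/= Sf _] [/= Sf' _] _.
  move=> [a [c [z [/= ma ac -> kz]]]] [a' [c' [z' [/= ma' ac' -> kz']]]].
  have aa' := mul_sq_inj m0 ma ma'; subst a'.
  have cc' : c = c'.
    have a0 : a != 0 by apply: contra_neq m0 => a0; rewrite ma a0 mul0r.
    by apply: (mulfI a0); rewrite ac ac'.
  subst c'.
  have [h Gh [/= fh zh]] := equiv_at_trans (equiv_at_sym kz) kz'.
  have ff' : f = f'.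
    have [s [_ s_uniq]] := Srep f (SF _ Sf).
    rewrite -(s_uniq f) ?(s_uniq f')//; split => //; first by exists h.
    by exists 1%:M; rewrite ?bqsubst1// /SL2Z /= det1.
  rewrite -ff' in fh *; congr (_, _); have [h' Gh' [hh' h'h]] := SL2Z_inv Gh.
  have SOh : SO f h by [].
  have SOh' : SO f h' by split => //; rewrite -[in LHS]fh -bqsubstM hh' bqsubst1.
  have SOM g1 g2 : SO f g1 -> SO f g2 -> SO f (g1 *m g2).
    move=> [G1 f1] [G2 f2]; split; last by rewrite bqsubstM f1 f2.
    by rewrite /SL2Z /= det_mulmx G1 G2 mulr1.
  apply/seteqP; split=> _ [g SOg <-].
    by exists (g *m h); [exact: SOM|rewrite zh mulmxA].
  by exists (g *m h'); [exact: SOM|rewrite zh mulmxA -(mulmxA g) h'h mulmx1].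
Qed.

Theorem mainTheorem2 (R : realType) (d : int)
    (hd : (d = 0 %[mod 4])%Z \/ (d = 1 %[mod 4])%Z)
    (S : set bqform) (hS : representatives d S) :
  (forall m : int, m != 0 -> (C R S m < +oo)%E) /\
  (forall m n : int, m != 0 -> n != 0 -> coprimez m n ->
     C R S (m * n) = (C R S m * C R S n)%E).
Proof.
have [e [c0 dE]] : exists e c0, d = e ^+ 2 - 4 * c0.
  case: hd => /eqP; rewrite eqz_mod_dvd => /dvdzP[q qE].
    by exists 0, (- q); lia.
  by exists 1, (- q); lia.
split=> [m m0|m n m0 n0 mn].
  rewrite (C_normal_data R dE hS m0) /counting asboolT ?ltry//.
  exact: finite_normal_data.
rewrite !(C_normal_data R dE hS) ?mulf_neq0//.
exact: counting_normal_dataM.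
Qed.
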